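(* Let $k$ be a field and let $0<\varepsilon<1$ be a real number. Then there exists a graded $k$-algebra $R$ with sharp entropy such that $1+\frac{1}{3}\varepsilon\leq H(R)\leq 1+3\varepsilon$.
   Context: Algebras are associative over $k$. For a graded $k$-algebra $R=\bigoplus_{i\geq 0}R_i$ with $\dim_k R_i<\infty$ for all $i$, the entropy of $R$ is $H(R)=\limsup_{n\to\infty}\sqrt[n]{\dim_k\bigoplus_{i\leq n}R_i}$. A graded algebra $R$ (with finite-dimensional homogeneous components) has sharp entropy if every proper quotient of $R$ has entropy strictly smaller than $H(R)$; here proper quotients are the graded algebras $R/I$ with $I\neq 0$ a homogeneous two-sided ideal. *)

(* Defs.v *)
From HB Require Import structures.
From mathcomp Require Import all_boot all_order all_algebra.
From mathcomp Require Import all_classical all_reals all_analysis.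

Set Implicit Arguments.
Unset Strict Implicit.
Unset Printing Implicit Defensive.

Import Order.TTheory GRing.Theory Num.Theory.

Local Open Scope ring_scope.
Local Open Scope quotient_scope.

(* Unital associative algebras in which 1 = 0 is allowed: [algType] excludes
   the zero algebra, which is needed here as the quotient R / R. *)
Record pzAlg (k : pzRingType) := PzAlg {
  pzalg_mod : lmodType k;
  pzalg_one : pzalg_mod;
  pzalg_mul : pzalg_mod -> pzalg_mod -> pzalg_mod;
  pzalg_mulA : associative pzalg_mul;
  pzalg_mul1l : left_id pzalg_one pzalg_mul;
  pzalg_mul1r : right_id pzalg_one pzalg_mul;
  pzalg_mulDl : left_distributive pzalg_mul +%R;
  pzalg_mulDr : right_distributive pzalg_mul +%R;
  pzalg_scaleAl : forall c x y, c *: pzalg_mul x y = pzalg_mul (c *: x) y;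
  pzalg_scaleAr : forall c x y, c *: pzalg_mul x y = pzalg_mul x (c *: y)
}.

(* The ring and module structures are attached to this alias, because HB does
   not admit a structure joining [pzRingType] and [lmodType] below [lalgType]. *)
Definition pzalg_sort (k : pzRingType) (A : pzAlg k) : Type := pzalg_mod A.
Coercion pzalg_sort : pzAlg >-> Sortclass.

Section PzAlgTheory.
Variables (k : pzRingType) (A : pzAlg k).

HB.instance Definition _ := GRing.Lmodule.on (pzalg_sort A).
HB.instance Definition _ := GRing.Zmodule_isPzRing.Build (pzalg_sort A)
  (@pzalg_mulA k A) (@pzalg_mul1l k A) (@pzalg_mul1r k A)
  (@pzalg_mulDl k A) (@pzalg_mulDr k A).

Lemma pzscalerAl (c : k) (x y : A) : c *: (x * y) = c *: x * y.
Proof. exact: pzalg_scaleAl. Qed.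

Lemma pzscalerAr (c : k) (x y : A) : c *: (x * y) = x * (c *: y).
Proof. exact: pzalg_scaleAr. Qed.

End PzAlgTheory.

(* [ring_quotient] only provides proper one-sided ideals, and quotient rings
   only in the commutative case. *)
HB.mixin Record isTwoSided (A : pzRingType) (I : A -> bool) := {
  ideal_mull : forall a u, u \in I -> a * u \in I;
  ideal_mulr : forall a u, u \in I -> u * a \in I
}.

#[short(type="idealType")]
HB.structure Definition TwoSidedIdeal (A : pzRingType) :=
  {I of GRing.ZmodClosed A I & isTwoSided A I}.

Section QuotientAlgebra.
Variables (k : pzRingType) (A : pzAlg k) (I : idealType A).

Definition quot_type : Type := {ideal_quot I}.

HB.instance Definition _ := GRing.Zmodule.on quot_type.

Definition quot_proj (x : A) : quot_type := \pi_{ideal_quot I} x.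

Lemma quot_projP x y : reflect (quot_proj x = quot_proj y) (x - y \in I).
Proof. by rewrite Quotient.idealrBE; apply: eqP. Qed.

Lemma quot_proj_repr (q : quot_type) : quot_proj (repr (q : {ideal_quot I})) = q.
Proof. exact: reprK. Qed.

Lemma quot_ind (P : quot_type -> Prop) : (forall x, P (quot_proj x)) -> forall q, P q.
Proof. by move=> Px q; rewrite -(quot_proj_repr q). Qed.

Lemma quot_projD x y : quot_proj (x + y) = quot_proj x + quot_proj y.
Proof. by rewrite /quot_proj raddfD. Qed.

Lemma quot_proj0 : quot_proj 0 = 0.
Proof. by rewrite /quot_proj raddf0. Qed.

Definition quot_mul (p q : quot_type) : quot_type :=
  quot_proj (repr (p : {ideal_quot I}) * repr (q : {ideal_quot I})).

Definition quot_scale (c : k) (q : quot_type) : quot_type :=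
  quot_proj (c *: repr (q : {ideal_quot I})).

Lemma quot_mulE x y : quot_mul (quot_proj x) (quot_proj y) = quot_proj (x * y).
Proof.
rewrite /quot_mul; set x' := repr (quot_proj x : {ideal_quot I}).
set y' := repr (quot_proj y : {ideal_quot I}); apply/quot_projP.
have Ix : x' - x \in I by apply/quot_projP; exact: quot_proj_repr.
have Iy : y' - y \in I by apply/quot_projP; exact: quot_proj_repr.
have -> : x' * y' - x * y = (x' - x) * y' + x * (y' - y).
  by rewrite mulrBl mulrBr addrA subrK.
by apply: rpredD; [exact: ideal_mulr|exact: ideal_mull].
Qed.

Lemma ideal_scale (c : k) u : u \in I -> c *: u \in I.
Proof. by move=> Iu; rewrite -[u]mul1r pzscalerAl ideal_mull. Qed.

Lemma quot_scaleE c x : quot_scale c (quot_proj x) = quot_proj (c *: x).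
Proof.
apply/quot_projP; rewrite -scalerBr ideal_scale //.
by apply/quot_projP; exact: quot_proj_repr.
Qed.

Fact quot_mulA : associative quot_mul.
Proof.
elim/quot_ind=> x; elim/quot_ind=> y; elim/quot_ind=> z.
by rewrite !quot_mulE mulrA.
Qed.

Fact quot_mul1l : left_id (quot_proj 1) quot_mul.
Proof. by elim/quot_ind=> x; rewrite quot_mulE mul1r. Qed.

Fact quot_mul1r : right_id (quot_proj 1) quot_mul.
Proof. by elim/quot_ind=> x; rewrite quot_mulE mulr1. Qed.

Fact quot_mulDl : left_distributive quot_mul +%R.
Proof.
elim/quot_ind=> x; elim/quot_ind=> y; elim/quot_ind=> z.
by rewrite -quot_projD !quot_mulE -quot_projD mulrDl.
Qed.

Fact quot_mulDr : right_distributive quot_mul +%R.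
Proof.
elim/quot_ind=> x; elim/quot_ind=> y; elim/quot_ind=> z.
by rewrite -quot_projD !quot_mulE -quot_projD mulrDr.
Qed.

Fact quot_scaleA c d q : quot_scale c (quot_scale d q) = quot_scale (c * d) q.
Proof. by elim/quot_ind: q => x; rewrite !quot_scaleE scalerA. Qed.

Fact quot_scale1 : left_id 1 quot_scale.
Proof. by elim/quot_ind=> x; rewrite quot_scaleE scale1r. Qed.

Fact quot_scaleDr : right_distributive quot_scale +%R.
Proof.
move=> c; elim/quot_ind=> x; elim/quot_ind=> y.
by rewrite -quot_projD !quot_scaleE -quot_projD scalerDr.
Qed.

Fact quot_scaleDl q : {morph quot_scale^~ q : c d / c + d}.
Proof. by elim/quot_ind: q => x c d; rewrite !quot_scaleE -quot_projD scalerDl. Qed.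

HB.instance Definition _ := GRing.Zmodule_isLmodule.Build k quot_type
  quot_scaleA quot_scale1 quot_scaleDr quot_scaleDl.

Fact quot_scaleAl (c : k) p q : c *: quot_mul p q = quot_mul (c *: p) q.
Proof.
elim/quot_ind: p => x; elim/quot_ind: q => y.
by rewrite /GRing.scale /= !(quot_mulE, quot_scaleE) pzscalerAl.
Qed.

Fact quot_scaleAr (c : k) p q : c *: quot_mul p q = quot_mul p (c *: q).
Proof.
elim/quot_ind: p => x; elim/quot_ind: q => y.
by rewrite /GRing.scale /= !(quot_mulE, quot_scaleE) pzscalerAr.
Qed.

Definition quot_alg : pzAlg k :=
  PzAlg quot_mulA quot_mul1l quot_mul1r quot_mulDl quot_mulDr
    quot_scaleAl quot_scaleAr.

Definition quot_pi (x : A) : quot_alg := quot_proj x.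

Lemma quot_piP (x y : A) : reflect (quot_pi x = quot_pi y) (x - y \in I).
Proof. exact: quot_projP. Qed.

Lemma quot_pi_surj (q : quot_alg) : exists x, quot_pi x = q.
Proof. by elim/quot_ind: q => x; exists x. Qed.

Lemma quot_pi0 : quot_pi 0 = 0. Proof. exact: quot_proj0. Qed.

Lemma quot_pi1 : quot_pi 1 = 1. Proof. by []. Qed.

Lemma quot_piD x y : quot_pi (x + y) = quot_pi x + quot_pi y.
Proof. exact: quot_projD. Qed.

Lemma quot_piM x y : quot_pi (x * y) = quot_pi x * quot_pi y.
Proof. exact/esym/quot_mulE. Qed.

Lemma quot_piZ (c : k) x : quot_pi (c *: x) = c *: quot_pi x.
Proof. exact/esym/quot_scaleE. Qed.

Lemma quot_pi_sum n (f : nat -> A) :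
  quot_pi (\sum_(i < n) f i) = \sum_(i < n) quot_pi (f i).
Proof. exact: (big_morph _ quot_piD quot_pi0). Qed.

End QuotientAlgebra.

(* A = \bigoplus_(i >= 0) A_i with A = [galg] and A_i = [hcomp i] *)
Record gradedAlg (k : fieldType) := GradedAlg {
  galg :> pzAlg k;
  hcomp : nat -> {pred galg};
  hcomp_submod : forall i, submod_closed (hcomp i);
  hcomp1 : 1 \in hcomp 0;
  hcompM : forall i j x y,
    x \in hcomp i -> y \in hcomp j -> x * y \in hcomp (i + j);
  hcomp_sum : forall x, exists n (f : nat -> galg),
    (forall i, f i \in hcomp i) /\ x = \sum_(i < n) f i;
  hcomp_direct : forall n (f : nat -> galg),
    (forall i, f i \in hcomp i) -> \sum_(i < n) f i = 0 ->
    forall i, (i < n)%N -> f i = 0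
}.

Arguments hcomp {k} g i.

Definition homogeneous (k : fieldType) (R : gradedAlg k) (I : idealType R) :=
  forall n (f : nat -> R), (forall i, f i \in hcomp R i) ->
    \sum_(i < n) f i \in I -> forall i, (i < n)%N -> f i \in I.

Section GradedQuotient.
Variables (k : fieldType) (R : gradedAlg k) (I : idealType R).
Hypothesis homI : homogeneous I.

Definition quot_hcomp (i : nat) : {pred quot_alg I} :=
  [pred q | `[< exists2 x, x \in hcomp R i & quot_pi I x = q >]].

Lemma quot_hcompP i q :
  reflect (exists2 x, x \in hcomp R i & quot_pi I x = q) (q \in quot_hcomp i).
Proof. exact: asboolP. Qed.

Fact quot_hcomp_submod i : submod_closed (quot_hcomp i).
Proof.
have [H0 HD] := hcomp_submod R i; split=> [|c p q].
  by apply/quot_hcompP; exists 0; rewrite ?quot_pi0.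
move=> /quot_hcompP[x Hx <-] /quot_hcompP[y Hy <-].
by apply/quot_hcompP; exists (c *: x + y); rewrite ?HD ?quot_piD ?quot_piZ.
Qed.

Fact quot_hcomp1 : 1 \in quot_hcomp 0.
Proof. by apply/quot_hcompP; exists 1; rewrite ?hcomp1. Qed.

Fact quot_hcompM i j p q :
  p \in quot_hcomp i -> q \in quot_hcomp j -> p * q \in quot_hcomp (i + j).
Proof.
move=> /quot_hcompP[x Hx <-] /quot_hcompP[y Hy <-].
by apply/quot_hcompP; exists (x * y); rewrite ?hcompM ?quot_piM.
Qed.

Fact quot_hcomp_sum q : exists n (f : nat -> quot_alg I),
  (forall i, f i \in quot_hcomp i) /\ q = \sum_(i < n) f i.
Proof.
have [x <-] := quot_pi_surj q; have [n [f [Hf ->]]] := hcomp_sum x.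
exists n, (fun i => quot_pi I (f i)); split; last exact: quot_pi_sum.
by move=> i; apply/quot_hcompP; exists (f i).
Qed.

Fact quot_hcomp_direct n (f : nat -> quot_alg I) :
  (forall i, f i \in quot_hcomp i) -> \sum_(i < n) f i = 0 ->
  forall i, (i < n)%N -> f i = 0.
Proof.
move=> Hf sf0 i lt_in.
have /choice[g Hg] j : exists x, x \in hcomp R j /\ quot_pi I x = f j.
  by have /quot_hcompP[x ? ?] := Hf j; exists x.
rewrite -(Hg i).2 -quot_pi0; apply/quot_piP; rewrite subr0.
apply: (homI _ _ lt_in) => [j|]; first exact: (Hg j).1.
rewrite -[X in X \in _]subr0; apply/quot_piP.
rewrite (quot_pi_sum I n g) quot_pi0 -[RHS]sf0.
by apply: eq_bigr => j _; exact: (Hg j).2.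
Qed.

Definition quot_graded : gradedAlg k :=
  GradedAlg quot_hcomp_submod quot_hcomp1 quot_hcompM quot_hcomp_sum
    quot_hcomp_direct.

End GradedQuotient.

Section Dimension.
Variables (k : fieldType) (V : lmodType k).

Definition lspans n (b : 'I_n -> V) (W : {pred V}) :=
  forall v, v \in W <-> exists c : 'I_n -> k, v = \sum_(i < n) c i *: b i.

Definition lfree n (b : 'I_n -> V) :=
  forall c : 'I_n -> k, \sum_(i < n) c i *: b i = 0 -> forall i, c i = 0.

Definition finite_dim (W : {pred V}) := exists n (b : 'I_n -> V), lspans b W.

(* The cardinality of a basis of W; 0 by convention if W is infinite-dimensional. *)
Definition dimension (W : {pred V}) : nat :=
  xget 0%N [set d | exists b : 'I_d -> V, lfree b /\ lspans b W]%classic.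

End Dimension.

Section Entropy.
Variables (F : realType) (k : fieldType).
Implicit Type R : gradedAlg k.

Definition locally_finite R := forall i, finite_dim (hcomp R i).

(* \bigoplus_(i <= n) R_i *)
Definition truncation R (n : nat) : {pred R} :=
  [pred x | `[< exists f : nat -> R,
     (forall i, f i \in hcomp R i) /\ x = \sum_(i < n.+1) f i >]].
Arguments truncation R n : clear implicits.

(* Taken in the extended reals, since the limsup may be infinite; the term
   n = 0 has no influence on it. *)
Definition entropy R : \bar F :=
  limn_esup (fun n => ((dimension (truncation R n))%:R `^ n%:R^-1)%:E).

Definition sharp_entropy R :=
  locally_finite R /\
  forall (I : idealType R) (homI : homogeneous I),
    (exists2 x, x \in I & x != 0) ->
    (entropy (quot_graded homI) < entropy R)%E.

End Entropy.

Arguments truncation {k} R n.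

(* Main.v *)
(* R is the free algebra on two letters, both placed in degree d; its entropy is
   2 ^ (1 / d). Choose d minimal with 2 ^ (1 / d) <= 1 + 3 eps: if d >= 2 then
   (1 + eps / 3) ^ d <= (1 + eps / 3) ^ (2 (d - 1)) <= (1 + 3 eps) ^ (d - 1) < 2,
   which is the lower bound. For sharpness, a nonzero homogeneous ideal I contains
   w0 - g with w0 a word of length m and g a combination of the other words of
   length m. Cutting a word into blocks of length m and replacing each block w0 by
   g, one sees that R / I is spanned by the words none of whose blocks is w0, so
   the entropy of R / I is at most (2 ^ m - 1) ^ (1 / (d m)) < 2 ^ (1 / d). *)
Require Import Defs.
From mathcomp Require Import all_boot all_order all_algebra finmap.
From mathcomp Require Import all_classical all_reals all_analysis.
From mathcomp Require Import zify lra.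
(* The notations of monalg clash with those of mathcomp-analysis. *)
From mathcomp Require Import -(notations) monalg.
Import Order.TTheory GRing.Theory Num.Theory.
Import numFieldNormedType.Exports.
Local Open Scope classical_set_scope.
Local Open Scope ring_scope.

(** * Limsup estimates *)

Lemma le_limn_esup (F : realType) (u v : nat -> \bar F) :
  (\forall n \near \oo, u n <= v n)%E -> (limn_esup u <= limn_esup v)%E.
Proof.
move=> [N _ leuv]; rewrite !limn_esup_lim.
apply: lee_lim; [exact: is_cvg_esups|exact: is_cvg_esups|].
exists N => // m /= Nm; apply: ge_ereal_sup => _ [n /= mn <-].
apply: (le_trans (leuv n _)); first exact: leq_trans mn.
by apply: ereal_sup_ubound; exists n.
Qed.

(** Since c^(1/n) = exp(ln c / n) tends to 1, a constant positive factor in the dimensions does not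
    affect the entropy. *)
Lemma cvg_root_const (F : realType) (c a : F) : 0 < c ->
  (fun n => (c `^ n%:R^-1 * a)%:E) @ \oo --> a%:E.
Proof.
move=> c0; apply: cvg_EFin; first exact: nearW.
rewrite -[X in _ --> X]mul1r.
apply: cvgM; last exact: cvg_cst.
rewrite (_ : nbhs (1 : F) = nbhs (expR (0 * ln c))); last by rewrite mul0r expR0.
rewrite [X in X @ _ --> _](_ : _ = fun n => expR (n%:R^-1 * ln c)); last first.
  by apply/funext => n; rewrite /powR gt_eqF.
apply: continuous_cvg; first exact: continuous_expR.
apply: cvgM; last exact: cvg_cst.
by rewrite -(cvg_shiftS (fun n => n%:R^-1 : F)) /=; exact: cvg_harmonic.
Qed.

Section EntropyBounds.
Variables (F : realType) (k : fieldType) (R : gradedAlg k).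
Variables (N D : nat).
Hypotheses (N_gt0 : (0 < N)%N) (D_gt0 : (0 < D)%N).

Let N_gt0F : 0 < N%:R :> F. Proof. by rewrite ltr0n. Qed.

Let root_powR n : (0 < n)%N ->
  (N%:R `^ (n%:R / D%:R)) `^ n%:R^-1 = N%:R `^ D%:R^-1 :> F.
Proof. by move=> n0; rewrite -powRrM mulrAC divff ?mul1r ?pnatr_eq0 -?lt0n. Qed.

(** The factor [C] disappears in the limit, and [n %/ D] is at most the real quotient n / D. *)
Lemma entropy_le (C : nat) : (0 < C)%N ->
    (forall n, (dimension (truncation R n) <= C * N ^ (n %/ D))%N) ->
  (entropy F R <= (N%:R `^ D%:R^-1)%:E)%E.
Proof.
move=> C0 dimR; have C0F : 0 < C%:R :> F by rewrite ltr0n.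
have [_ <-] := cvg_limn_einf_sup (cvg_root_const F _ (N%:R `^ D%:R^-1) C0F).
apply: le_limn_esup; exists 1%N => // n /= n0; rewrite lee_fin.
rewrite -(root_powR _ n0) -powRM ?powR_ge0 ?ler0n//.
apply: ge0_ler_powR; rewrite ?invr_ge0 ?nnegrE ?mulr_ge0 ?powR_ge0 ?ler0n//.
have := dimR n; rewrite -(ler_nat F) => /le_trans; apply.
rewrite natrM natrX ler_wpM2l ?ler0n// -powR_mulrn ?ler0n//.
by rewrite ler_powR ?ler1n// ler_pdivlMr ?ltr0n// -natrM ler_nat leq_trunc_div.
Qed.

(** Rounding n / D down loses less than one factor [N]; the resulting constant [N%:R^-1] disappears
    in the limit. *)
Lemma entropy_ge :
    (forall n, (N ^ (n %/ D) <= dimension (truncation R n))%N) ->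
  ((N%:R `^ D%:R^-1)%:E <= entropy F R)%E.
Proof.
move=> dimR; have V0 : 0 < N%:R^-1 :> F by rewrite invr_gt0.
have [_ <-] := cvg_limn_einf_sup (cvg_root_const F _ (N%:R `^ D%:R^-1) V0).
apply: le_limn_esup; exists 1%N => // n /= n0; rewrite lee_fin.
rewrite -(root_powR _ n0) -powRM ?powR_ge0 ?invr_ge0 ?ler0n//.
apply: ge0_ler_powR;
  rewrite ?invr_ge0 ?nnegrE ?mulr_ge0 ?powR_ge0 ?invr_ge0 ?ler0n//.
have := dimR n; rewrite -(ler_nat F); apply: le_trans.
rewrite mulrC ler_pdivrMr// -natrM -expnSr natrX -powR_mulrn ?ler0n//.
by rewrite ler_powR ?ler1n// ler_pdivrMr ?ltr0n// -natrM ler_nat ltnW// ltn_ceil.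
Qed.

End EntropyBounds.

(** * Choice of the degree *)

Lemma ex_root2_between (F : realType) (eps : F) : 0 < eps -> eps < 1 ->
  exists2 d : nat, (0 < d)%N &
    1 + 3^-1 * eps <= 2%:R `^ d%:R^-1 <= 1 + 3 * eps.
Proof.
move=> e0 e1.
have P : exists d, (2 : F) <= (1 + 3 * eps) ^+ d.
  have := archi_boundP (ltW (divr_gt0 ltr01 e0)); set n := Num.bound _.
  rewrite ltr_pdivrMr// => hn; exists n.
  (* Bernoulli's inequality; as n * eps > 1, it makes the power at [n] exceed 2. *)
  have B : forall m, 1 + m%:R * (3 * eps) <= (1 + 3 * eps) ^+ m.
    elim=> [|m IH]; first by rewrite mul0r addr0.
    rewrite exprS -natr1; have m0 : 0 <= m%:R :> F by [].
    have : (1 + 3 * eps) * (1 + m%:R * (3 * eps)) <=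
        (1 + 3 * eps) * (1 + 3 * eps) ^+ m.
      by rewrite ler_wpM2l//; lra.
    have : 0 <= m%:R * (eps * eps) by rewrite mulr_ge0// mulr_ge0// ltW.
    lra.
  have := B n; lra.
case: (ex_minnP P) => d dP dmin.
have d0 : (0 < d)%N by case: d dP {dmin} => //; lra.
have root x : 0 <= x -> x = (x ^+ d) `^ d%:R^-1.
  move=> x0; rewrite -powR_mulrn// -powRrM divff ?powRr1//.
  by rewrite pnatr_eq0 -lt0n.
have inv0 : 0 <= d%:R^-1 :> F by rewrite invr_ge0.
exists d => //; apply/andP; split; last first.
  rewrite [leRHS]root; last by lra.
  by apply: ge0_ler_powR; rewrite // nnegrE ?exprn_ge0//; lra.
rewrite [leLHS]root; last by lra.
apply: ge0_ler_powR; rewrite // ?nnegrE ?exprn_ge0//; first by lra.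
case: d d0 dP dmin root inv0 => [//|[|d]] _ dP dmin _ _; first by lra.
have lt2 : (1 + 3 * eps) ^+ d.+1 < 2.
  by rewrite ltNge; apply/negP => /dmin; rewrite ltnn.
apply/ltW/(le_lt_trans _ lt2).
(* After the case split the minimal exponent is [d.+2], and d + 2 <= 2 (d + 1). *)
apply: (@le_trans _ _ ((1 + 3^-1 * eps) ^+ (2 * d.+1))).
  by apply: ler_weXn2l; [lra|rewrite mul2n -addnn addSn ltnS leq_addl].
rewrite exprM lerXn2r ?nnegrE ?exprn_ge0//; try lra.
(* This yields (1 + eps / 3)^2 <= 1 + 7 eps / 9 <= 1 + 3 eps. *)
have : eps * eps <= eps * 1 by rewrite ler_pM2l// ltW.
rewrite expr2; lra.
Qed.

Local Close Scope classical_set_scope.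

(** * Dimension *)

Section DimensionTheory.
Variables (k : fieldType) (V : lmodType k).

(** Freeness of [b] says that the matrix [M] of its coordinates along [e] has trivial left kernel,
    so [M] has rank [n], which is at most its number of columns. *)
Lemma lfree_leq_span n m (b : 'I_n -> V) (e : 'I_m -> V) : lfree b ->
  (forall i, exists c, b i = \sum_(j < m) c j *: e j) -> (n <= m)%N.
Proof.
move=> freeb /choice[c bE]; pose M : 'M[k]_(n, m) := \matrix_(i, j) c i j.
suff /eqP <- : row_free M by exact: rank_leq_col.
rewrite -kermx_eq0; apply/eqP/row_matrixP => i; rewrite row0; set r := row i _.
have rM : r *m M = 0 by apply/sub_kermxP; exact: row_sub.
apply/rowP => j; rewrite [RHS]mxE; move: j; apply: freeb.
under eq_bigr do rewrite bE scaler_sumr.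
rewrite exchange_big big1 //= => l _.
under eq_bigr do rewrite scalerA.
rewrite -scaler_suml (_ : \sum_i _ = (r *m M) 0 l); last first.
  by rewrite [RHS]mxE; apply: eq_bigr => i' _; rewrite [M _ _]mxE.
by rewrite rM mxE scale0r.
Qed.

Lemma lspans_mem (W : {pred V}) n (b : 'I_n -> V) : lspans b W ->
  forall i, b i \in W.
Proof.
move=> spanb i; apply/spanb.
exists (fun j => (j == i)%:R); rewrite (bigD1 i)//= eqxx scale1r big1 ?addr0//.
by move=> j /negPf ->; rewrite scale0r.
Qed.

Lemma dimension_leq_span (W : {pred V}) m (e : 'I_m -> V) :
  (forall v, v \in W -> exists c, v = \sum_(j < m) c j *: e j) ->
  (dimension W <= m)%N.
Proof.
(* When [W] has no finite basis, [dimension] takes its default value 0 and the bound is trivial. *)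
move=> spanW; rewrite /dimension; case: xgetP => // d _ [b [freeb spanb]].
apply: (lfree_leq_span _ _ _ _ freeb) => i.
exact/spanW/(lspans_mem _ _ _ spanb).
Qed.

Lemma dimensionE (W : {pred V}) n (b : 'I_n -> V) :
  lfree b -> lspans b W -> dimension W = n.
Proof.
move=> freeb spanb; apply/eqP; rewrite eqn_leq.
rewrite (dimension_leq_span _ _ b)/=; last by move=> v /spanb.
rewrite /dimension; case: xgetP => [d _ [e [freee spane]]|]; last first.
  by move=> /(_ n)[]; exists b.
apply: (lfree_leq_span _ _ _ _ freeb) => i.
exact/spane/(lspans_mem _ _ _ spanb).
Qed.

End DimensionTheory.

(** * The free algebra on two letters of degree d *)

Local Notation word := (fmonom bool).

Section FreeAlgebra.
Variable k : fieldType.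
Local Notation A := (malg word k).
Local Notation mono w := (mkmalgU w (1 : k) : A).
Implicit Types (x y : A) (w u v : word) (P Q T : pred word).

Lemma malg_scalerAr (c : k) x y : c *: (x * y) = x * (c *: y).
Proof.
apply/malgP => w; rewrite mcoeffZ mcoeffMl.
rewrite (mcoeffMlw _ (fsubset_refl _) (msuppZ_le c y)) mulr_sumr.
apply: eq_bigr => u _; rewrite mulr_sumr; apply: eq_bigr => v _.
by rewrite mcoeffZ mulrCA mulrnAr.
Qed.

(** The monoid algebra of the free monoid on [bool] is the free algebra on two letters. *)
Definition free_pzAlg : pzAlg k :=
  @PzAlg k A 1 *%R (@mulrA A) (@mul1r A) (@mulr1 A) (@mulrDl A) (@mulrDr A)
    (@scalerAl k A) malg_scalerAr.

Definition supported P : {pred A} := [pred x : A | all P (msupp x)].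

Lemma supportedP P x :
  reflect (forall w, ~~ P w -> mcoeff w x = 0) (x \in supported P).
Proof.
apply: (iffP allP) => [Px w /negP Pw|Px w].
  by apply/eqP; rewrite mcoeff_eq0; apply/negP => /Px.
by apply: contraLR => /Px /eqP; rewrite mcoeff_eq0.
Qed.

Lemma supported_submod P : submod_closed (supported P).
Proof.
split=> [|c x y /supportedP xP /supportedP yP]; apply/supportedP => w Pw.
  by rewrite mcoeff0.
by rewrite mcoeffD mcoeffZ xP ?yP// mulr0 addr0.
Qed.

Lemma supportedS P Q x : {subset P <= Q} -> x \in supported P -> x \in supported Q.
Proof. by move=> PQ /allP xP; apply/allP => w /xP /PQ. Qed.

Lemma supported_mono P w : P w -> mono w \in supported P.
Proof.
move=> Pw; apply/supportedP => u Pu; rewrite mcoeffU.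
by case: eqP => // wu; rewrite -wu Pw in Pu.
Qed.

Lemma supportedM P Q T x y : (forall u v, P u -> Q v -> T (mmul u v)) ->
  x \in supported P -> y \in supported Q -> x * y \in supported T.
Proof.
move=> PQT /allP xP /allP yQ; apply/allP => w /msuppM_le[u [v [xu yv ->]]].
by apply: PQT; [exact: xP|exact: yQ].
Qed.

Lemma malg_sum_seq (s : seq word) x : uniq s -> x \in supported [in s] ->
  x = \sum_(i < size s) mcoeff (nth mone s i) x *: mono (nth mone s i).
Proof.
move=> us /supportedP xs; apply/malgP => w.
rewrite -(big_mkord xpredT (fun i => mcoeff (nth mone s i) x *: mono (nth mone s i))).
rewrite -(big_nth mone xpredT (fun u => mcoeff u x *: mono u)) raddf_sum /=.
have [ws|/xs xw0] := boolP (w \in s).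
  rewrite (bigD1_seq w)//= mcoeffZ mcoeffUU mulr1 big1 ?addr0// => u /negPf uw.
  by rewrite mcoeffZ mcoeffU uw mulr0.
rewrite xw0 big1_seq // => u /= us'; rewrite mcoeffZ mcoeffU.
by case: eqP => [uw|]; rewrite ?mulr0// uw xw0 mul0r.
Qed.

Lemma supported_lspans P (s : seq word) : uniq s -> s =i P ->
  lspans (fun i : 'I_(size s) => mono (nth mone s i)) (supported P).
Proof.
move=> us sP x; split=> [xP|[c ->]].
  exists (fun i => mcoeff (nth mone s i) x); apply: malg_sum_seq => //.
  by apply: supportedS xP => w; rewrite -sP.
have [s0 sZ] := supported_submod P.
elim/big_ind: _ => [//|y z ys zs|i _].
  by rewrite -[y]scale1r; exact: sZ.
rewrite -[_ *: _]addr0; apply: sZ s0; apply: supported_mono.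
by have := mem_nth mone (ltn_ord i); rewrite sP.
Qed.

Lemma mono_lfree (s : seq word) : uniq s ->
  lfree (fun i : 'I_(size s) => mono (nth mone s i)).
Proof.
move=> us c /(congr1 (mcoeff (nth mone s _))) sum0 i.
have := sum0 i; rewrite mcoeff0 raddf_sum /= (bigD1 i)//=.
rewrite mcoeffZ mcoeffUU mulr1 big1 ?addr0// => j ji.
by rewrite mcoeffZ mcoeffU nth_uniq// (negPf (ji : val j != val i)) mulr0.
Qed.

(** The projection onto the span of the words in [P]; for [degree_eq i] it extracts the homogeneous
    component of degree [i]. *)
Definition malg_restrict P x : A :=
  \sum_(w <- msupp x | P w) mcoeff w x *: mono w.

Lemma mcoeff_malg_restrict P x w :
  mcoeff w (malg_restrict P x) = if P w then mcoeff w x else 0.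
Proof.
rewrite /malg_restrict raddf_sum /=.
under eq_bigr do rewrite mcoeffZ mcoeffU.
case: (boolP (w \in msupp x)) => [xw|].
  rewrite -big_filter; case: ifP => Pw.
    rewrite (bigD1_seq w) ?mem_filter ?Pw ?filter_uniq ?fset_uniq//= eqxx mulr1.
    by rewrite big1 ?addr0// => u /negPf ->; rewrite mulr0.
  rewrite big1_seq// => u /=; rewrite mem_filter => /andP[Pu _].
  by case: eqP => [uw|]; rewrite ?mulr0//; rewrite -uw Pu in Pw.
rewrite -mcoeff_eq0 => /eqP xw; rewrite xw if_same big1 // => u _.
by case: eqP => [->|]; rewrite ?mulr0// xw mul0r.
Qed.

Lemma malg_restrict_supported P x : malg_restrict P x \in supported P.
Proof. by apply/supportedP => w /negPf Pw; rewrite mcoeff_malg_restrict Pw. Qed.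

Section Grading.
Variable d : nat.

Definition degree_eq i : pred word := fun w => (d * size w == i)%N.
Arguments degree_eq i w /.

Definition free_hcomp i : {pred A} := supported (degree_eq i).

(** A word has exactly one degree, so at most one summand can contain it. Directness of the grading
    and the shape of the truncations both follow from this. *)
Lemma mcoeff_sum_hcomp n (f : nat -> A) w :
  (forall i, f i \in free_hcomp i) ->
  mcoeff w (\sum_(i < n) f i) =
    if (d * size w < n)%N then mcoeff w (f (d * size w)%N) else 0.
Proof.
move=> fP; rewrite raddf_sum /=; case: ltnP => wn.
  rewrite (bigD1 (Ordinal wn))//= big1 ?addr0// => i iw.
  have /supportedP -> // := fP i.
  by apply: contra iw => /eqP iw; apply/eqP/val_inj.
rewrite big1 // => i _; have /supportedP -> // := fP i.
by apply/eqP => iw; have := ltn_ord i; rewrite -iw ltnNge wn.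
Qed.

Lemma malg_restrict_sum_hcomp n x :
  (forall w, (n <= d * size w)%N -> mcoeff w x = 0) ->
  x = \sum_(i < n) malg_restrict (degree_eq i) x.
Proof.
move=> xn; apply/malgP => w.
rewrite (mcoeff_sum_hcomp _ (fun i => malg_restrict (degree_eq i) x)); last first.
  by move=> i; exact: malg_restrict_supported.
by case: ltnP => [_|/xn ->//]; rewrite mcoeff_malg_restrict /= eqxx.
Qed.

Fact free_hcomp1 : (1 : A) \in free_hcomp 0.
Proof. by apply: supported_mono; rewrite /= fm1 muln0. Qed.

Fact free_hcompM i j x y : x \in free_hcomp i -> y \in free_hcomp j ->
  x * y \in free_hcomp (i + j).
Proof.
apply: supportedM => u v /= /eqP <- /eqP <-.
by rewrite fmM size_cat mulnDr.
Qed.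

Fact free_hcomp_sum x : exists n (f : nat -> A),
  (forall i, f i \in free_hcomp i) /\ x = \sum_(i < n) f i.
Proof.
(* One more than the largest degree occurring in [x], because the sum runs over indices strictly
   below the bound. *)
exists (\max_(w <- msupp x) (d * size w)).+1%N.
exists (fun i => malg_restrict (degree_eq i) x); split.
  by move=> i; exact: malg_restrict_supported.
apply: malg_restrict_sum_hcomp => w; apply: contraTeq.
rewrite mcoeff_neq0 -ltnNge ltnS => xw.
exact: (@leq_bigmax_seq _ _ xpredT (fun w : word => d * size w)%N).
Qed.

Fact free_hcomp_direct n (f : nat -> A) : (forall i, f i \in free_hcomp i) ->
  \sum_(i < n) f i = 0 -> forall i, (i < n)%N -> f i = 0.
Proof.
move=> fP sum0 i ilt; apply/malgP => w; rewrite mcoeff0.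
have [wi|] := eqVneq (d * size w)%N i; last first.
  by move=> wi; have /supportedP -> // := fP i.
by have := mcoeff_sum_hcomp n f w fP; rewrite sum0 wi ilt mcoeff0.
Qed.

Definition free_graded : gradedAlg k :=
  @GradedAlg k free_pzAlg free_hcomp (fun i => supported_submod _) free_hcomp1
    free_hcompM free_hcomp_sum free_hcomp_direct.

Lemma truncation_free n :
  truncation free_graded n =i supported [pred w : word | d * size w <= n]%N.
Proof.
move=> x; apply/asboolP/supportedP => [[f [fP ->]] w /= wn|xn].
  by rewrite (mcoeff_sum_hcomp n.+1 f w fP) ltnS (negPf wn).
exists (fun i => malg_restrict (degree_eq i) x); split.
  by move=> i; exact: malg_restrict_supported.
by apply: malg_restrict_sum_hcomp => w nw; apply: xn; rewrite /= -ltnNge.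
Qed.

End Grading.

End FreeAlgebra.

(** * Counting words, and the entropy of the free algebra *)

Definition words n : seq word := [seq FMonom (val t) | t : n.-tuple bool].

Lemma mem_words n w : (w \in words n) = (size w == n).
Proof.
apply/mapP/eqP => [[t _ ->]|<-]; first exact: size_tuple.
by exists (in_tuple w); rewrite ?mem_enum//= fmK.
Qed.

Lemma words_uniq n : uniq (words n).
Proof.
by rewrite map_inj_uniq ?enum_uniq// => s t [st]; exact: val_inj.
Qed.

Lemma size_words n : size (words n) = (2 ^ n)%N.
Proof. by rewrite size_map -cardE card_tuple card_bool. Qed.

Fixpoint words_leq n := if n is m.+1 then words_leq m ++ words n else words 0.

Lemma mem_words_leq n w : (w \in words_leq n) = (size w <= n)%N.
Proof.
elim: n => [|n IH]; first by rewrite mem_words leqn0.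
by rewrite mem_cat IH mem_words orbC -leq_eqVlt.
Qed.

Lemma words_leq_uniq n : uniq (words_leq n).
Proof.
elim: n => [|n IH]; first exact: words_uniq.
rewrite cat_uniq IH words_uniq andbT; apply/hasPn => w.
by rewrite mem_words mem_words_leq => /eqP ->; rewrite ltnn.
Qed.

(** The geometric sum 1 + 2 + ... + 2^n, with a successor on the left in place of a truncated
    subtraction on the right. *)
Lemma size_words_leq n : (size (words_leq n)).+1 = (2 ^ n.+1)%N.
Proof.
elim: n => [|n IH]; first by rewrite size_words.
by rewrite size_cat -addSn IH size_words addnn -mul2n -expnS.
Qed.

Section FreeAlgebraDimensions.
Variables (k : fieldType) (d : nat).
Hypothesis d_gt0 : (0 < d)%N.
Local Notation R := (free_graded k d).

Lemma free_locally_finite : locally_finite R.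
Proof.
move=> i; pose s := [seq w <- words_leq i | d * size (w : word) == i]%N.
exists (size s); eexists; apply: supported_lspans.
  by rewrite filter_uniq ?words_leq_uniq.
move=> w; rewrite mem_filter mem_words_leq; apply: andb_idr => /eqP <-.
by rewrite leq_pmull.
Qed.

(** Degree at most [n] means length at most [n %/ d], and the words form a basis. *)
Lemma dimension_truncation_free n :
  (dimension (truncation R n)).+1 = (2 ^ (n %/ d).+1)%N.
Proof.
rewrite -size_words_leq; congr _.+1.
apply: (dimensionE _ _ _ _ _ (mono_lfree k _ (words_leq_uniq _))) => v.
rewrite truncation_free; move: v; apply: supported_lspans.
  exact: words_leq_uniq.
by move=> w; rewrite mem_words_leq leq_divRL// mulnC.
Qed.

Lemma entropy_free (F : realType) : entropy F R = (2%:R `^ d%:R^-1)%:E.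
Proof.
apply/eqP; rewrite eq_le; apply/andP; split.
  apply: (@entropy_le _ _ _ _ _ _ _ 2) => // n.
  by rewrite -expnS -dimension_truncation_free.
apply: entropy_ge => // n.
by rewrite -ltnS dimension_truncation_free ltn_exp2l.
Qed.

End FreeAlgebraDimensions.

(** * Quotients of the free algebra *)

Section IdealElement.
Variables (k : fieldType) (d : nat) (I : idealType (free_graded k d)).
Local Notation R := (free_graded k d).
Local Notation mono w := (mkmalgU w (1 : k) : R).

Lemma monoM u v : mono (mmul u v) = mono u * mono v.
Proof. by rewrite /GRing.mul/= malgM_def fgmulUU mulr1. Qed.

(* The two extra letters make the length at least 2, so that (2 ^ size w).-1 >= 2
   and the geometric sum in [size_reduced] has no linear factor. *)
Lemma ex_reducible_word (x : R) : (0 < d)%N -> homogeneous I ->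
  x \in I -> x != 0 ->
  exists (w : word) (g : R), [/\ (2 <= size w)%N,
    g \in supported k [pred u : word | (size u == size w) && (u != w)] &
    mono w - g \in I].
Proof.
move=> d_gt0 homI; have [n [f [fP ->]]] := hcomp_sum x => sumI sum_neq0.
have [i ltin fi0] : exists2 i, (i < n)%N & f i != 0.
  apply: contrapT => nex; move/eqP: sum_neq0; apply.
  apply: big1 => i _; apply/eqP; apply: contrapT => /negP fi0.
  by apply: nex; exists i.
have fiI := homI n f fP sumI i ltin.
have [w] : exists w, w \in msupp (f i : malg word k).
  by apply/fset0Pn; rewrite msupp_eq0.
rewrite -mcoeff_neq0 => fw.
have /supportedP fiP := fP i.
have dw : (d * size w = i)%N.
  by apply/eqP; apply: contrapT => /negP /fiP fw0; rewrite fw0 eqxx in fw.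
(* Scaling by [a] gives [w] coefficient 1 in [a *: f i]; since [d] is positive, the other words
   there have the same length as [w]. *)
pose a := (mcoeff w (f i : malg word k))^-1.
pose z : word := FMonom [:: true; true].
exists (mmul w z), ((mono w - a *: f i) * mono z); split.
- by rewrite fmM size_cat /= addn2.
- apply: (supportedM _ [pred u : word | (size u == size w) && (u != w)] (pred1 z)).
  + move=> u v /= /andP[su uw] /eqP ->.
    rewrite !fmM !size_cat eqn_add2r su /=.
    (* The prefixes have equal length, so distinct words remain distinct after [z] is appended. *)
    by apply: contra uw; rewrite !fmP !fmM eqseq_cat ?(eqP su)// => /andP[].
  + apply/supportedP => u /=; rewrite mcoeffB mcoeffZ mcoeffU.
    have [-> _|uw /=] := eqVneq u w; first by rewrite mulVf// subrr.
    rewrite andbT => su; rewrite fiP ?mulr0 ?subrr//=.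
    by rewrite /degree_eq -dw eqn_pmul2l.
  + exact: supported_mono.
- by rewrite monoM mulrBl opprB addrC subrK ideal_mulr// ideal_scale.
Qed.

End IdealElement.

(** * Block reduction modulo the ideal *)

Section Reduction.
Variable w0 : word.
Local Notation m := (size w0).
Local Notation N := (2 ^ m).-1.

(* The words of length m other than w0; [reduced q] consists of the words with at
   most q blocks followed by a remainder of length less than m. *)
Definition blocks : seq word := rem w0 (words m).

Lemma mem_blocks u : (u \in blocks) = (size u == m) && (u != w0).
Proof. by rewrite mem_rem_uniq ?words_uniq// !inE mem_words andbC. Qed.

Fixpoint reduced q : seq word :=
  words_leq m.-1 ++
  if q is p.+1 then [seq mmul u v | u <- blocks, v <- reduced p] else [::].

Lemma size_reduced q : (2 <= m)%N -> (size (reduced q) <= 2 * N * N ^ q)%N.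
Proof.
(* The summand 2 makes the induction work: the sizes satisfy s' = N + N s, and N + N s + 2 <= N (s +
   2) as soon as N >= 2. *)
move=> m2; suff: (size (reduced q) + 2 <= 2 * N * N ^ q)%N.
  by apply: leq_trans; rewrite leq_addr.
(* [N] plays two roles: it counts the words shorter than [m] and also the blocks. *)
have sw : size (words_leq m.-1) = N.
  by rewrite -[LHS]/(size _).+1.-1 size_words_leq prednK// ltnW.
have N2 : (2 <= N)%N.
  have : (2 ^ 2 <= 2 ^ m)%N by rewrite leq_exp2l.
  by case: (2 ^ m)%N => [|[|[|]]].
elim: q => [|q IH] /=.
  by rewrite cats0 sw expn0 muln1 mul2n -addnn leq_add2l.
rewrite size_cat size_allpairs sw size_rem ?mem_words// size_words expnS.
by move: N (N ^ q)%N (size (reduced q)) N2 IH => a b c; nia.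
Qed.

Variables (k : fieldType) (d : nat) (I : idealType (free_graded k d)).
Local Notation R := (free_graded k d).
Local Notation mono w := (mkmalgU w (1 : k) : R).
Variable g : R.
Hypotheses (m_gt0 : (0 < m)%N) (gP : g \in supported k [in blocks])
  (gI : mono w0 - g \in I).

(** Blocks are cut off at fixed positions from the left: the first one is replaced by [g] if it is
    [w0], and the induction treats the rest, shorter by [m]. The errors stay in [I] because uv - hy
    = (u - h) v + h (v - y) and [I] is two-sided. *)
Lemma reduce_mono q (w : word) : (size w < q.+1 * m)%N ->
  exists2 y : R, y \in supported k [in reduced q] & mono w - y \in I.
Proof.
elim: q w => [|q IH] w sw.
  exists (mono w); last by rewrite subrr rpred0.
  apply: supported_mono; rewrite /= mem_cat mem_words_leq.
  by rewrite -ltnS prednK// -[m]mul1n sw.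
have [wm|mw] := ltnP (size w) m.
  exists (mono w); last by rewrite subrr rpred0.
  by apply: supported_mono; rewrite /= mem_cat mem_words_leq -ltnS prednK// wm.
pose u : word := FMonom (take m w); pose v : word := FMonom (drop m w).
have su : size u = m by rewrite size_takel.
have [|y yP yI] := IH v; first by rewrite size_drop ltn_subLR// -mulSn.
have [h hP hI] : exists2 h : R, h \in supported k [in blocks] & mono u - h \in I.
  have [uw|uw] := eqVneq u w0; first by exists g; rewrite ?uw.
  exists (mono u); last by rewrite subrr rpred0.
  by apply: supported_mono; rewrite /= mem_blocks su eqxx.
exists (h * y).
  apply: (supportedM k _ _ _ _ _ _ hP yP) => s t /= sb tr.
  by rewrite mem_cat (allpairs_f _ sb tr) orbT.
have -> : w = mmul u v by apply/eqP; rewrite fmP fmM cat_take_drop.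
rewrite monoM (_ : _ - _ = (mono u - h) * mono v + h * (mono v - y)).
  by apply: rpredD; [exact: ideal_mulr|exact: ideal_mull].
by rewrite mulrBl mulrBr addrA subrK.
Qed.

(** Linear extension of [reduce_mono], word by word along the support of [x]. *)
Lemma reduce q (x : R) :
  (forall w : word, w \in msupp (x : malg word k) -> (size w < q.+1 * m)%N) ->
  exists2 y : R, y \in supported k [in reduced q] & x - y \in I.
Proof.
move=> xq.
have /choice[y yP] (w : word) : exists y : R, (size w < q.+1 * m)%N ->
    y \in supported k [in reduced q] /\ mono w - y \in I.
  have [/reduce_mono[y]|_] := ltnP (size w) (q.+1 * m); last by exists 0.
  by exists y.
have [s0 sZ] := supported_submod k [in reduced q].
exists (\sum_(w <- msupp (x : malg word k)) mcoeff w (x : malg word k) *: y w).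
  rewrite big_seq; elim/big_ind: _ => [//|a b aP bP|w /xq/yP[ywP _]].
    by rewrite -[a]scale1r; exact: sZ.
  by rewrite -[_ *: _]addr0; exact: sZ.
rewrite [x in x - _](_ : _ =
  \sum_(w <- msupp (x : malg word k)) mcoeff w (x : malg word k) *: mono w).
  rewrite -sumrB big_seq rpred_sum// => w /xq/yP[_ ywI].
  by rewrite -scalerBr ideal_scale.
rewrite [LHS]monalgE; apply: eq_bigr => w _; apply/malgP => u.
by rewrite mcoeffZ !mcoeffU mulrnAr mulr1.
Qed.

Hypotheses (d_gt0 : (0 < d)%N) (homI : homogeneous I).

(** Lift an element of the truncation to the free algebra, reduce it there and project back: the
    images of the reduced words span. *)
Lemma dimension_truncation_quot n : (2 <= m)%N ->
  (dimension (truncation (quot_graded homI) n) <= 2 * N * N ^ (n %/ (d * m)))%N.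
Proof.
move=> m2; set q := (n %/ _)%N.
apply: leq_trans (size_reduced q m2).
apply: leq_trans (size_undup (reduced q)).
set s := undup _.
apply: (dimension_leq_span _ _ _ _ (fun i => quot_pi I (mono (nth mone s i)))) => v.
move=> /asboolP[f [fP ->]].
(* Homogeneous representatives keep the lifted sum in degrees at most [n]. *)
have /choice[h hP] i : exists x, x \in hcomp R i /\ quot_pi I x = f i.
  by have /quot_hcompP[x ? ?] := fP i; exists x.
have hn : \sum_(i < n.+1) h i \in truncation R n.
  by apply/asboolP; exists h; split=> // i; exact: (hP i).1.
have [w|y yP xy] := reduce q (\sum_(i < n.+1) h i).
  move: hn; rewrite truncation_free => /allP /(_ w) + xw => /(_ xw) /= wn.
  (* Here d |w| <= n < (q + 1) d m, so |w| < (q + 1) m. *)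
  rewrite -(ltn_pmul2l d_gt0) (leq_ltn_trans wn)//.
  by rewrite mulnCA ltn_ceil// muln_gt0 d_gt0.
have ys : y \in supported k [in s].
  by apply: supportedS yP => w; rewrite -topredE /= -topredE /= mem_undup.
exists (fun i => mcoeff (nth mone s i) (y : malg word k)).
transitivity (quot_pi I y).
  rewrite -(quot_piP _ _ _ xy) quot_pi_sum.
  by apply: eq_bigr => i _; rewrite (hP i).2.
rewrite {1}(malg_sum_seq k s y (undup_uniq _) ys).
rewrite (quot_pi_sum I _
  (fun i => mcoeff (nth mone s i) (y : malg word k) *: mono (nth mone s i))).
by apply: eq_bigr => i _; rewrite quot_piZ.
Qed.

End Reduction.

(** * Sharpness and conclusion *)

Lemma free_sharp (F : realType) (k : fieldType) (d : nat) : (0 < d)%N ->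
  sharp_entropy F (free_graded k d).
Proof.
move=> d0; split=> [|I homI [x xI x0]]; first exact: free_locally_finite.
have [w [g [w2 gP gI]]] := ex_reducible_word k d I x d0 homI xI x0.
have w_gt0 : (0 < size w)%N by exact: ltnW.
have gB : g \in supported k [in blocks w].
  by apply: supportedS gP => u; rewrite !inE mem_blocks.
have N0 : (0 < (2 ^ size w).-1)%N.
  by rewrite -ltnS prednK ?expn_gt0// -{1}(expn0 2) ltn_exp2l.
apply: (@le_lt_trans _ _ ((2 ^ size w).-1%:R `^ (d * size w)%:R^-1)%:E).
  apply: (entropy_le _ _ _ _ _ N0 _ (2 * (2 ^ size w).-1)) => [||n].
  - by rewrite muln_gt0 d0.
  - by rewrite muln_gt0.
  - exact: dimension_truncation_quot gB gI _ _ _ _.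
rewrite entropy_free// lte_fin.
(* Both entropies become powers with the same exponent 1 / (d m), so it remains to compare the bases
   2^m - 1 and 2^m, where m is the length of [w]. *)
have -> : 2%:R `^ d%:R^-1 = (2 ^ size w)%:R `^ (d * size w)%:R^-1 :> F.
  rewrite natrX -powR_mulrn// -powRrM; congr (_ `^ _).
  by rewrite natrM invfM mulrCA divff ?mulr1// pnatr_eq0 -lt0n.
rewrite gt0_ltr_powR ?invr_gt0 ?ltr0n ?muln_gt0 ?d0 ?nnegrE ?ler0n//.
by rewrite ltr_nat ltn_predL expn_gt0.
Qed.

Theorem corollary3p1 (F : realType) (k : fieldType) (eps : F)
    (eps_gt0 : 0 < eps) (eps_lt1 : eps < 1) :
  exists R : gradedAlg k,
    sharp_entropy F R /\
    ((1 + 3^-1 * eps)%:E <= entropy F R)%E /\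
    (entropy F R <= (1 + 3 * eps)%:E)%E.
Proof.
have [d d0 /andP[le_d ge_d]] := ex_root2_between F eps eps_gt0 eps_lt1.
exists (free_graded k d); rewrite entropy_free// !lee_fin.
by split; first exact: free_sharp.
Qed.
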